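(* Let $ABC$ be a nondegenerate triangle in the Euclidean plane whose orthocenter $H$ lies inside $\triangle ABC$. Let lines $AH$, $BH$, $CH$ meet the sides $BC$, $CA$, $AB$ at $D$, $E$, $F$, respectively, so that the cevians $AD$, $BE$, $CF$ divide $\triangle ABC$ into the six triangles $T_1=HBD$, $T_2=HDC$, $T_3=HCE$, $T_4=HEA$, $T_5=HAF$, $T_6=HFB$. Let $C_i$ be the circumcircle of $T_i$ and let $R_i$ be the radius of $C_i$, for $i=1,\dots,6$. Then $R_1=R_6$, $R_2=R_3$, and $R_4=R_5$.
   Context: A cevian through a point is a segment from a vertex of the triangle through that point to the opposite side. *)

(* Defs.v *)
From Stdlib Require Import Reals.
Local Open Scope R_scope.

(** The Euclidean plane, in Cartesian coordinates over Stdlib's reals. *)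
Definition point : Type := (R * R)%type.

Definition dist (P Q : point) : R :=
  dist_euc (fst P) (snd P) (fst Q) (snd Q).

Definition vec (P Q : point) : R * R := (fst Q - fst P, snd Q - snd P).

Definition dot (u v : R * R) : R := fst u * fst v + snd u * snd v.

Definition affine_comb (t : R) (P Q : point) : point :=
  ((1 - t) * fst P + t * fst Q, (1 - t) * snd P + t * snd Q).

(** A line only if [P <> Q]; [line P P] is the single point [P]. *)
Definition line (P Q X : point) : Prop :=
  exists t : R, X = affine_comb t P Q.

(** The closed segment, endpoints included. *)
Definition segment (P Q X : point) : Prop :=
  exists t : R, 0 <= t <= 1 /\ X = affine_comb t P Q.

Definition collinear (A B C : point) : Prop :=
  exists P Q : point, P <> Q /\ line P Q A /\ line P Q B /\ line P Q C.

Definition nondegenerate (A B C : point) : Prop := ~ collinear A B C.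

(** The open interior: all three barycentric coordinates are positive. *)
Definition inside_triangle (A B C X : point) : Prop :=
  exists a b c : R,
    0 < a /\ 0 < b /\ 0 < c /\ a + b + c = 1 /\
    X = (a * fst A + b * fst B + c * fst C, a * snd A + b * snd B + c * snd C).

(** The altitude from [A] in triangle [A B C], as a full line: the points [X]
    such that [AX] is perpendicular to [BC]. *)
Definition altitude (A B C X : point) : Prop := dot (vec A X) (vec B C) = 0.

Definition orthocenter (A B C H : point) : Prop :=
  altitude A B C H /\ altitude B C A H /\ altitude C A B H.

Record circle : Type := Circle {
  center : point;
  radius : R;
  radius_pos : 0 < radius
}.

Definition on_circle (c : circle) (X : point) : Prop :=
  dist (center c) X = radius c.

Definition circumcircle (P Q S : point) (c : circle) : Prop :=
  on_circle c P /\ on_circle c Q /\ on_circle c S.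

(* Main.v *)
(** The cevians are altitudes, so each of the six triangles has a right angle at
    [D], [E] or [F], and its circumradius is half its hypotenuse, which joins
    [H] to a vertex.  The two triangles sharing the hypotenuse [HB] (resp. [HC],
    [HA]) therefore have the same circumradius.  That [H] is interior ensures
    that none of the right triangles is degenerate. *)

Require Import Defs.
From Stdlib Require Import Reals Lra.
Local Open Scope R_scope.

(** Twice the signed area, as a cross product: its vanishing is an algebraic test for
    collinearity. *)
Definition area2 (P Q S : point) : R :=
  fst (vec P Q) * snd (vec P S) - snd (vec P Q) * fst (vec P S).

Lemma area2_refl_r (P Q : point) : area2 P Q Q = 0.
Proof. unfold area2; ring. Qed.

Lemma area2_affine_comb (P Q X Y : point) (t : R) :
  area2 P Q (affine_comb t X Y) = (1 - t) * area2 P Q X + t * area2 P Q Y.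
Proof. unfold area2, affine_comb, vec; simpl; ring. Qed.

Lemma line_left (P Q : point) : line P Q P.
Proof.
  exists 0; destruct P, Q; unfold affine_comb; simpl; f_equal; ring.
Qed.

Lemma line_right (P Q : point) : line P Q Q.
Proof.
  exists 1; destruct P, Q; unfold affine_comb; simpl; f_equal; ring.
Qed.

Lemma segment_line (P Q X : point) : segment P Q X -> line P Q X.
Proof. intros [t [_ ht]]; exists t; exact ht. Qed.

Lemma line_sym (P Q X : point) : line P Q X -> line Q P X.
Proof.
  intros [t ->]; exists (1 - t); unfold affine_comb; f_equal; ring.
Qed.

Lemma normsq_vec_neq0 (P Q : point) :
  P <> Q -> dot (vec P Q) (vec P Q) <> 0.
Proof.
  destruct P as [px py], Q as [qx qy]; unfold dot, vec; simpl; intros hne h.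
  destruct (Rplus_sqr_eq_0 _ _ h); apply hne; f_equal; lra.
Qed.

Lemma area2_eq0_line (P Q X : point) :
  P <> Q -> area2 P Q X = 0 -> line P Q X.
Proof.
  intros hne h; assert (hn := normsq_vec_neq0 P Q hne).
  (* The parameter of the orthogonal projection of [X] onto the line. The error in each coordinate,
     times [n], is a multiple of [area2 P Q X]. *)
  exists (dot (vec P Q) (vec P X) / dot (vec P Q) (vec P Q)).
  destruct P as [px py], Q as [qx qy], X as [x y].
  unfold area2, dot, vec, affine_comb in *; simpl in *.
  set (n := (qx - px) * (qx - px) + (qy - py) * (qy - py)) in *.
  f_equal; apply (Rmult_eq_reg_r n); try exact hn; field_simplify; try exact hn;
    unfold n.
  - apply Rminus_diag_uniq.
    transitivity (- (qy - py) * ((qx - px) * (y - py) - (qy - py) * (x - px)));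
      [ring | rewrite h; ring].
  - apply Rminus_diag_uniq.
    transitivity ((qx - px) * ((qx - px) * (y - py) - (qy - py) * (x - px)));
      [ring | rewrite h; ring].
Qed.

Lemma point_eq_dec (P Q : point) : {P = Q} + {P <> Q}.
Proof.
  destruct P as [a b], Q as [c d].
  destruct (Req_dec_T a c) as [-> | h]; [destruct (Req_dec_T b d) as [-> | h]|];
    [left; reflexivity | right | right]; congruence.
Qed.

Lemma nondegenerate_area2 (A B C : point) :
  nondegenerate A B C -> area2 A B C <> 0.
Proof.
  intros hnd h; apply hnd.
  (* Collinearity asks for a line through two distinct points, so coinciding vertices need another
     choice of line. *)
  destruct (point_eq_dec A B) as [<- | hAB].
  - destruct (point_eq_dec A C) as [<- | hAC].
    + exists A, (fst A + 1, snd A); split.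
      * destruct A as [x y]; simpl; intros e; injection e; lra.
      * repeat split; apply line_left.
    + exists A, C; repeat split; auto using line_left, line_right.
  - exists A, B; repeat split; auto using line_left, line_right, area2_eq0_line.
Qed.

Lemma nondegenerate_rotate (A B C : point) :
  nondegenerate A B C -> nondegenerate B C A.
Proof.
  intros h [P [Q [hne [h1 [h2 h3]]]]]; apply h; exists P, Q; auto.
Qed.

Lemma nondegenerate_swap (A B C : point) :
  nondegenerate A B C -> nondegenerate A C B.
Proof.
  intros h [P [Q [hne [h1 [h2 h3]]]]]; apply h; exists P, Q; auto.
Qed.

Lemma inside_triangle_rotate (A B C X : point) :
  inside_triangle A B C X -> inside_triangle B C A X.
Proof.
  intros [a [b [c [ha [hb [hc [hs ->]]]]]]]; exists b, c, a.
  repeat split; try lra; f_equal; ring.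
Qed.

Lemma inside_triangle_swap (A B C X : point) :
  inside_triangle A B C X -> inside_triangle A C B X.
Proof.
  intros [a [b [c [ha [hb [hc [hs ->]]]]]]]; exists a, c, b.
  repeat split; try lra; f_equal; ring.
Qed.

Lemma altitude_swap (A B C X : point) : altitude A B C X -> altitude A C B X.
Proof. unfold altitude, dot, vec; simpl; lra. Qed.

(** The barycentric coordinate [a > 0] is the ratio of the areas of [X B C] and [A B C]. *)
Lemma inside_area2_neq0 (A B C X : point) :
  nondegenerate A B C -> inside_triangle A B C X -> area2 B C X <> 0.
Proof.
  intros hnd [a [b [c [ha [hb [hc [hs ->]]]]]]].
  apply nondegenerate_area2 in hnd.
  replace (area2 B C _) with (a * area2 A B C).
  - apply Rmult_integral_contrapositive_currified; lra.
  - replace c with (1 - a - b) by lra; unfold area2, vec; simpl; ring.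
Qed.

Lemma cevian_foot_neq_point (A B C H D : point) :
  nondegenerate A B C -> inside_triangle A B C H -> line B C D -> D <> H.
Proof.
  intros hnd hin [s hs] e; apply (inside_area2_neq0 A B C H hnd hin).
  rewrite <- e, hs, area2_affine_comb, area2_refl_r.
  unfold area2, vec; simpl; ring.
Qed.

(** If [D = B], then [A], [B] and [D = A + t (H - A)] span zero area, so [t = 0] because [A B H] has
    nonzero area; but then [D = A], hence [A = B]. *)
Lemma cevian_foot_neq_vertex (A B C H D : point) :
  nondegenerate A B C -> inside_triangle A B C H -> line A H D -> D <> B.
Proof.
  intros hnd hin [t ht] e.
  assert (hABH : area2 A B H <> 0).
  { apply (inside_area2_neq0 C A B); auto using
      nondegenerate_rotate, inside_triangle_rotate. }
  assert (h : t * area2 A B H = 0).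
  { transitivity (area2 A B D).
    - rewrite ht, area2_affine_comb; unfold area2, vec; simpl; ring.
    - rewrite e; apply area2_refl_r. }
  apply Rmult_integral in h; destruct h as [-> | h]; [| auto].
  apply (nondegenerate_area2 A B C hnd).
  replace A with B; [unfold area2, vec; simpl; ring|].
  rewrite <- e, ht; destruct A; unfold affine_comb; simpl; f_equal; ring.
Qed.

(** [DH] is a multiple of [AH] and [DB] a multiple of [BC], and these directions are
    perpendicular. *)
Lemma altitude_foot_right_angle (A B C H D : point) :
  altitude A B C H -> line A H D -> line B C D -> dot (vec D H) (vec D B) = 0.
Proof.
  intros halt [t ht] [s hs]; unfold altitude in halt.
  transitivity ((1 - t) * - s * dot (vec A H) (vec B C)).
  - replace (vec D H) with ((1 - t) * fst (vec A H), (1 - t) * snd (vec A H)).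
    + rewrite hs; unfold dot, affine_comb, vec; simpl; ring.
    + rewrite ht; unfold affine_comb, vec; simpl; f_equal; ring.
  - rewrite halt; ring.
Qed.

Lemma dist_sqr (P Q : point) : Rsqr (Defs.dist P Q) = dot (vec P Q) (vec P Q).
Proof.
  unfold Defs.dist, dist_euc; rewrite Rsqr_sqrt.
  - unfold dot, vec, Rsqr; simpl; ring.
  - apply Rplus_le_le_0_compat; apply Rle_0_sqr.
Qed.

Lemma right_triangle_circumradius (P Q S : point) (c : circle) :
  S <> P -> S <> Q -> dot (vec S P) (vec S Q) = 0 ->
  circumcircle P Q S c -> 2 * radius c = Defs.dist P Q.
Proof.
  intros hP hQ hright [cP [cQ cS]].
  apply normsq_vec_neq0 in hP, hQ.
  apply (f_equal Rsqr) in cP, cQ, cS; rewrite dist_sqr in cP, cQ, cS.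
  apply Rsqr_inj.
  { pose proof (radius_pos c); lra. }
  { apply sqrt_pos. }
  rewrite dist_sqr, Rsqr_mult, <- cS.
  destruct (center c) as [ox oy], P as [px py], Q as [qx qy], S as [sx sy].
  unfold dot, vec in *; simpl in *.
  (* Relative to [S], the vector [w = 2 O - P - Q] is orthogonal to both of the
     independent vectors [P] and [Q], hence is zero: [O] is the midpoint. *)
  set (wx := 2 * ox - px - qx); set (wy := 2 * oy - py - qy).
  set (ux := px - sx) in *; set (uy := py - sy) in *.
  set (vx := qx - sx) in *; set (vy := qy - sy) in *.
  (* With [o = O - S], equidistance from [S] and [P] gives [2 o.u = u.u], and the right angle gives
     [u.v = 0]; likewise for [v]. *)
  assert (hu : wx * ux + wy * uy = 0) by (unfold wx, wy, ux, uy, vx, vy in *; nra).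
  assert (hv : wx * vx + wy * vy = 0) by (unfold wx, wy, ux, uy, vx, vy in *; nra).
  assert (hd : ux * vy - uy * vx <> 0).
  { intros hd.
    (* Lagrange's identity: the product of the squared norms is the squared dot product plus the
       squared cross product. *)
    assert (h : (ux * ux + uy * uy) * (vx * vx + vy * vy) = 0).
    { transitivity (Rsqr (ux * vx + uy * vy) + Rsqr (ux * vy - uy * vx)).
      - unfold Rsqr; ring.
      - rewrite hright, hd; unfold Rsqr; ring. }
    apply Rmult_integral in h; tauto. }
  (* Cramer's rule for the system [hu], [hv], with determinant nonzero by [hd]. *)
  assert (hx : wx = 0).
  { apply (Rmult_eq_reg_r (ux * vy - uy * vx)); auto.
    transitivity ((wx * ux + wy * uy) * vy - (wx * vx + wy * vy) * uy); [ring|].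
    rewrite hu, hv; ring. }
  assert (hy : wy = 0).
  { apply (Rmult_eq_reg_r (ux * vy - uy * vx)); auto.
    transitivity ((wx * vx + wy * vy) * ux - (wx * ux + wy * uy) * vx); [ring|].
    rewrite hu, hv; ring. }
  unfold wx in hx; unfold wy in hy.
  replace ox with ((px + qx) / 2) by lra.
  replace oy with ((py + qy) / 2) by lra.
  (* Twice the vector from [O] to [S] is [-(u + v)], and the diagonals [u + v] and [u - v] of a
     rectangle have equal length. *)
  transitivity ((ux + vx) * (ux + vx) + (uy + vy) * (uy + vy)).
  { unfold ux, uy, vx, vy, Rsqr; field. }
  transitivity ((ux - vx) * (ux - vx) + (uy - vy) * (uy - vy)
                + 4 * (ux * vx + uy * vy)); [ring|].
  rewrite hright; unfold ux, uy, vx, vy; ring.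
Qed.

Lemma altitude_foot_circumradius (A B C H D : point) (c : circle) :
  nondegenerate A B C -> inside_triangle A B C H -> altitude A B C H ->
  line A H D -> line B C D -> circumcircle H B D c ->
  2 * radius c = Defs.dist H B.
Proof.
  intros hnd hin halt hAH hBC hc.
  apply (right_triangle_circumradius H B D); auto.
  - exact (cevian_foot_neq_point A B C H D hnd hin hBC).
  - exact (cevian_foot_neq_vertex A B C H D hnd hin hAH).
  - exact (altitude_foot_right_angle A B C H D halt hAH hBC).
Qed.

Lemma altitude_foot_circumradii (A B C H D : point) (c c' : circle) :
  nondegenerate A B C -> inside_triangle A B C H -> altitude A B C H ->
  line A H D /\ segment B C D ->
  circumcircle H B D c -> circumcircle H D C c' ->
  2 * radius c = Defs.dist H B /\ 2 * radius c' = Defs.dist H C.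
Proof.
  intros hnd hin halt [hAH hBC%segment_line] hc [h1 [h2 h3]]; split.
  - eapply (altitude_foot_circumradius A B C); eauto.
  (* The other half of the side follows by exchanging [B] and [C]. *)
  - eapply (altitude_foot_circumradius A C B H D);
      auto using nondegenerate_swap, inside_triangle_swap, altitude_swap,
        line_sym.
    repeat split; assumption.
Qed.

Theorem theorem2p5 (A B C H D E F : point) (C1 C2 C3 C4 C5 C6 : circle)
  (hABC : nondegenerate A B C)
  (hH : orthocenter A B C H)
  (hHin : inside_triangle A B C H)
  (hD : line A H D /\ segment B C D)
  (hE : line B H E /\ segment C A E)
  (hF : line C H F /\ segment A B F)
  (hC1 : circumcircle H B D C1)
  (hC2 : circumcircle H D C C2)
  (hC3 : circumcircle H C E C3)
  (hC4 : circumcircle H E A C4)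
  (hC5 : circumcircle H A F C5)
  (hC6 : circumcircle H F B C6) :
  radius C1 = radius C6 /\ radius C2 = radius C3 /\ radius C4 = radius C5.
Proof.
  destruct hH as [altA [altB altC]].
  assert (hBCA := nondegenerate_rotate A B C hABC).
  assert (hCAB := nondegenerate_rotate B C A hBCA).
  assert (hHin' := inside_triangle_rotate A B C H hHin).
  assert (hHin'' := inside_triangle_rotate B C A H hHin').
  (* Cyclic relabelling treats the three altitudes alike; the doubled radii are in turn [HB], [HC],
     [HC], [HA], [HA], [HB]. *)
  destruct (altitude_foot_circumradii A B C H D C1 C2) as [r1 r2]; auto.
  destruct (altitude_foot_circumradii B C A H E C3 C4) as [r3 r4]; auto.
  destruct (altitude_foot_circumradii C A B H F C5 C6) as [r5 r6]; auto.
  lra.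
Qed.
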